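(* Let $m\ge 3$ be an odd integer, and let $h$ be the least common multiple of the cardinalities $|C_1|,\ldots,|C_r|$ of the distinct cyclotomic cosets $C_1,\ldots,C_r$ of $2$ modulo $m$. Then the exact exponent $\alpha=\alpha(m)$ in the remainder term of the formula $T^{(j)}_{m,a}(x)=\frac{x}{2m}+O(x^{\lambda})$, where $\lambda=\frac{\ln 3}{\ln 4}$, $a\in\{0,1,\ldots,m-1\}$ and $j\in\{0,1\}$, is $$\alpha=\max_{1\le l\le m-1}\left(1+\frac{1}{h\ln 2}\sum_{k=0}^{h-1}\ln\left|\sin\frac{\pi l 2^k}{m}\right|\right).$$
   Context: For a nonnegative integer $n$, $s(n)$ denotes the number of $1$'s in the binary expansion of $n$. For an integer $m>1$, an integer $a\in[0,m-1]$ and $j\in\{0,1\}$, put $$T^{(j)}_{m,a}(x)=\#\{n\in\mathbb{Z}: 0\le n<x,\ n\equiv a \pmod m,\ s(n)\equiv j \pmod 2\}.$$ The exact exponent in the remainder term is the number $\alpha=\alpha(m)$ such that for every $\varepsilon>0$, as $x\to\infty$, $$T^{(j)}_{m,a}(x)=\frac{x}{2m}+O(x^{\alpha+\varepsilon})\quad\text{and}\quad T^{(j)}_{m,a}(x)=\frac{x}{2m}+\Omega(x^{\alpha-\varepsilon}),$$ for $a\in\{0,\ldots,m-1\}$ and $j\in\{0,1\}$ (the same $\alpha$, depending only on $m$, serves for all such $a$ and $j$). Here $f(x)=\Omega(g(x))$ with $g>0$ has the usual analytic number theory meaning that $f(x)\ne o(g(x))$, i.e. $\limsup_{x\to\infty}|f(x)|/g(x)>0$.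 For odd $m>1$, the cyclotomic cosets of $2$ modulo $m$ are the sets $\{t\cdot 2^i \bmod m: i\ge 0\}$ for $t\in\{1,\ldots,m-1\}$; the distinct ones $C_1,\ldots,C_r$ partition $\{1,2,\ldots,m-1\}$. *)

(* Defs.v *)
From HB Require Import structures.
From mathcomp Require Import all_boot all_order all_algebra finmap.
From mathcomp Require Import all_classical all_reals all_analysis.
Set Implicit Arguments.
Unset Strict Implicit.
Unset Printing Implicit Defensive.
Import Order.TTheory GRing.Theory Num.Theory.
Import numFieldNormedType.Exports.
Local Open Scope ring_scope.

(* Digits at positions i >= n are omitted: they vanish because n < 2 ^ n. *)
Definition binary_ones (n : nat) : nat := (\sum_(i < n) odd (n %/ 2 ^ i))%N.

(* The set is finite for every x, R being archimedean; otherwise fset_set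
   would return the empty set. *)
Definition ones_count (R : realType) (m a j : nat) (x : R) : nat :=
  #|` fset_set [set n : nat | [/\ (n%:R < x)%R, n = a %[mod m]
                               & binary_ones n = j %[mod 2]]%N]%classic |.

Definition remainder (R : realType) (m a j : nat) (x : R) : R :=
  (ones_count m a j x)%:R - x / (2 * m%:R).

(* The Landau notations need a filter_on, which the library does not declare
   for pinfty_nbhs. *)
Canonical at_infinity (R : realType) : filter_on R :=
  FilterType (pinfty_nbhs R) _.

(* Omega is the negation of little-o; the library's =Omega_ is the stronger
   "eventually at least a positive multiple of", and is not what is meant. *)
Definition is_exact_exponent (R : realType) (m : nat) (alpha : R) : Prop :=
  forall a j : nat, (a < m)%N -> (j < 2)%N -> forall eps : R, 0 < eps ->
    (remainder m a j : R -> R) =O_ (pinfty_nbhs R) (fun x : R => x `^ (alpha + eps)) /\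
    ~ ((remainder m a j : R -> R) =o_ (pinfty_nbhs R) (fun x : R => x `^ (alpha - eps))).

Definition cyclotomic_coset (m t : nat) : {set 'I_m} :=
  [set k : 'I_m | `[< exists i : nat, val k = (t * 2 ^ i) %% m >]]%N.

Definition cyclotomic_cosets (m : nat) : {set {set 'I_m}} :=
  [set cyclotomic_coset m t | t : 'I_m & val t != 0%N].

Definition coset_lcm (m : nat) : nat :=
  \big[lcmn/1%N]_(C in cyclotomic_cosets m) #|C|.

Definition exponent_term (R : realType) (m l : nat) : R :=
  let h := coset_lcm m in
  1 + (h%:R * ln 2)^-1 *
      \sum_(0 <= k < h) ln `| sin (pi * l%:R * 2 ^+ k / m%:R) |.

(* The maximum of a nonempty family, so it may start from the term l = 1. *)
Definition max_exponent (R : realType) (m : nat) : R :=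
  \big[Num.max/exponent_term R m 1]_(1 <= l < m) exponent_term R m l.

(* Main.v *)
Require Import Defs.
From HB Require Import structures.
From mathcomp Require Import all_boot all_order all_algebra finmap.
From mathcomp Require Import all_classical all_reals all_analysis.
From mathcomp Require Import complex.
From mathcomp Require Import ring lra zify.
Import Order.TTheory GRing.Theory Num.Theory.
Import numFieldNormedType.Exports.
Import Normc.
Local Open Scope ring_scope.

(** Write [s n] for the number of binary ones of [n].  Counting the [n < N] with
    [n = a] mod [m] and [s n = j] mod 2 by means of the indicator
    [(1 + (-1)^(j + s n)) / 2] shows that the remainder is, up to a bounded error,
    half of [(-1)^j S_a(N)], where [S_a(N)] ([residue_sum]) is the sum of
    [(-1)^(s n)] over the [n < N] congruent to [a]
    ([remainder_residue_sum]).  With [w = exp(2 i pi / m)], the discrete Fourier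
    transform exchanges the [S_a(N)] and the sums [F_l(N)] of
    [(-1)^(s n) w^(l n)] over [n < N] ([thue_morse_sum]; see
    [thue_morse_sum_residues] and [residue_sum_inversion]).

    Since [s] is additive on concatenations of binary blocks, [F_l(2^n)] is the
    product of the [1 - w^(l 2^k)] for [k < n]; its modulus is the product of
    the chords [2 |sin(pi l 2^k / m)|].  The factors are periodic in [k] with
    period [h], because the coset of 1 has as many elements as the order of 2
    modulo [m]; hence [|F_l(2^(q h))| = 2^(q h e_l)], where [e_l] is
    [exponent_term] ([prod_chord_period], [prod_chord_exponent]).

    Upper bounds.  Cutting [N] along its binary digits turns a bound
    [C rho^k] for all [|F_l(2^k)|], with [rho > 1], into one of the same order
    for all [|F_l(N)|], hence for the [S_a(N)] ([normc_thue_morse_sum_le],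
    [remainder_bigO]).  With [rho = sqrt 3] the hypothesis follows from
    [sin(t)^2 |sin(2t)| <= (sqrt 3 / 2)^3], which gives the exponent
    [ln 3 / ln 4].  With [rho = 2^alpha], [alpha] the maximum of the [e_l], it
    follows from the periodicity, once one knows [alpha > 0]: the product of
    [|1 - w^l|] over all nonzero [l] is [m > 1], so the [e_l] have a positive
    sum ([max_exponent_gt0]).

    Lower bound.  A bound [O(x^beta)] for one [S_a] passes to every [S_c] at the
    points [2^(q h)], since the part of [S_a] coming from the block
    [b 2^(q h) <= n < (b + 1) 2^(q h)] is, up to sign, [S_c(2^(q h))] with
    [c = a - b] ([residue_sum_transfer]).  Hence it passes to every
    [F_l(2^(q h))], and a maximal [e_l] is at most [beta]
    ([max_exponent_le_of_bigO]).  So the remainder is [O(x^alpha)] and not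
    [O(x^beta)] for any [beta < alpha], whatever [a] and [j] are; this makes
    [alpha] an exact exponent and leaves room for no other. *)

(** * Binary ones of concatenated blocks *)

Lemma binary_onesE (n K : nat) :
  (n < 2 ^ K)%N -> binary_ones n = (\sum_(i < K) odd (n %/ 2 ^ i))%N.
Proof.
have wide k : (n < 2 ^ k)%N -> forall d,
    (\sum_(i < k + d) odd (n %/ 2 ^ i) = \sum_(i < k) odd (n %/ 2 ^ i))%N.
  move=> nk d; rewrite big_split_ord /= [X in (_ + X)%N]big1 ?addn0// => i _.
  by rewrite divn_small// (leq_trans nk)// leq_exp2l// leq_addr.
by move=> nK; rewrite /binary_ones -(wide n (ltn_expl n (isT : (1 < 2)%N)) K) addnC wide.
Qed.

(** The binary expansion of [b * 2 ^ k + r] is that of [b] followed by the [k]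
    digits of [r]; this additivity is the source of every recursion below. *)
Lemma binary_ones_block (b k r : nat) : (r < 2 ^ k)%N ->
  binary_ones (b * 2 ^ k + r) = (binary_ones b + binary_ones r)%N.
Proof.
move=> rk; have ltbk : (b * 2 ^ k + r < 2 ^ (k + b))%N.
  rewrite expnD mulnC (leq_trans (n := 2 ^ k * b.+1))//.
    by rewrite mulnS addnC ltn_add2r.
  by rewrite leq_mul2l ltn_expl// orbT.
rewrite (binary_onesE _ _ ltbk) big_split_ord /= addnC; congr addn.
  apply: eq_bigr => i _.
  by rewrite expnD divnMA divnMDl ?expn_gt0// (divn_small rk) addn0.
rewrite (binary_onesE _ _ rk); apply: eq_bigr => i _.
(* Below position [k] the block [b] contributes an even quotient. *)
have [d dE] : exists d, k = (i + d.+1)%N.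
  by exists (k - i.+1)%N; have := ltn_ord i; lia.
rewrite [in (b * _)%N]dE expnD mulnCA mulnC divnMDl ?expn_gt0// oddD oddM.
by rewrite oddX andbF.
Qed.

(** * Sums over the Thue-Morse sequence *)

Definition thue_morse_sum (A : nzRingType) (z : A) (N : nat) : A :=
  \sum_(n < N) (-1) ^+ binary_ones n * z ^+ n.

Definition residue_sum (A : nzRingType) (m a N : nat) : A :=
  \sum_(n < N | n == a %[mod m]) (-1) ^+ binary_ones n.

Lemma thue_morse_sum_block (A : comNzRingType) (z : A) (b k M : nat) :
  (M <= 2 ^ k)%N ->
  thue_morse_sum A z (b * 2 ^ k + M) = thue_morse_sum A z (b * 2 ^ k) +
    (-1) ^+ binary_ones b * z ^+ (b * 2 ^ k) * thue_morse_sum A z M.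
Proof.
move=> Mk; rewrite /thue_morse_sum big_split_ord /=; congr (_ + _).
rewrite mulr_sumr; apply: eq_bigr => i _.
rewrite binary_ones_block ?(leq_trans (ltn_ord i) Mk)// !exprD.
by rewrite mulrACA.
Qed.

(** Inside the block [b] of length [2 ^ k] the residue class of [b * 2 ^ k + c]
    looks like the class of [c] at the origin. *)
Lemma residue_sum_block (A : nzRingType) (m b k c M : nat) : (M <= 2 ^ k)%N ->
  residue_sum A m (b * 2 ^ k + c) (b * 2 ^ k + M) =
    residue_sum A m (b * 2 ^ k + c) (b * 2 ^ k) +
    (-1) ^+ binary_ones b * residue_sum A m c M.
Proof.
move=> Mk; rewrite /residue_sum big_split_ord /=; congr (_ + _).
rewrite mulr_sumr; apply: eq_big => [i|i _]; first by rewrite eqn_modDl.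
by rewrite binary_ones_block ?(leq_trans (ltn_ord i) Mk)// exprD.
Qed.

(** The interval up to [2 ^ n.+1] is two blocks of length [2 ^ n], the second of
    which contributes the factor [- z ^+ (2 ^ n)] relative to the first. *)
Lemma thue_morse_sum_pow2 (A : comNzRingType) (z : A) (n : nat) :
  thue_morse_sum A z (2 ^ n) = \prod_(k < n) (1 - z ^+ (2 ^ k)).
Proof.
elim: n => [|n IH].
  by rewrite /thue_morse_sum big_ord0 expn0 big_ord1 /binary_ones big_ord0 !expr0 mulr1.
rewrite big_ord_recr /= -IH expnS mul2n -addnn -[X in (X + _)%N]mul1n.
rewrite thue_morse_sum_block// mul1n /binary_ones big_ord1 divn1 /= expr1 mulrC.
ring.
Qed.

Lemma residue_sum_map (A B : nzRingType) (f : {rmorphism A -> B}) (m a N : nat) :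
  f (residue_sum A m a N) = residue_sum B m a N.
Proof.
rewrite /residue_sum rmorph_sum; apply: eq_bigr => n _.
by rewrite rmorphXn rmorphN1.
Qed.

Lemma thue_morse_sum_residues (A : comNzRingType) (m : nat) (w : A) (l N : nat) :
  (0 < m)%N -> w ^+ m = 1 ->
  thue_morse_sum A (w ^+ l) N = \sum_(c < m) w ^+ (l * c) * residue_sum A m c N.
Proof.
move=> m0 wm; rewrite /thue_morse_sum.
rewrite (partition_big (fun n : 'I_N => Ordinal (ltn_pmod n m0)) xpredT)//=.
apply: eq_bigr => c _; rewrite mulr_sumr; apply: eq_big => [n|n].
  by rewrite -val_eqE /= (modn_small (ltn_ord c)).
move=> /eqP <- /=; rewrite mulrC -exprM; congr (_ * _).
rewrite {1}(divn_eq n m) mulnDr exprD mulnA [(_ * m)%N]mulnC exprM wm expr1n.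
by rewrite mul1r.
Qed.

(** The orthogonality relation behind Fourier inversion on the residues. *)
Lemma sum_primitive_root (A : idomainType) (m : nat) (w : A) (j : nat) :
  m.-primitive_root w ->
  \sum_(l < m) w ^+ (l * j) = if (m %| j)%N then m%:R else 0.
Proof.
move=> wP; case: ifP => [mj|/negbT mj].
  rewrite (eq_bigr (fun=> 1)) ?sumr_const ?card_ord// => l _.
  by apply/eqP; rewrite -(prim_order_dvd wP) dvdn_mull.
have wj : w ^+ j != 1 by rewrite -(prim_order_dvd wP).
apply: (mulfI (x := w ^+ j - 1)); first by rewrite subr_eq0.
rewrite mulr0 (eq_bigr (fun l : 'I_m => (w ^+ j) ^+ l)); last first.
  by move=> l _; rewrite -exprM mulnC.
by rewrite -subrX1 -exprM mulnC exprM (prim_expr_order wP) expr1n subrr.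
Qed.

Lemma residue_sum_inversion (A : idomainType) (m : nat) (w : A) (a N : nat) :
  m.-primitive_root w -> (a < m)%N ->
  m%:R * residue_sum A m a N =
    \sum_(l < m) w ^+ (l * (m - a)) * thue_morse_sum A (w ^+ l) N.
Proof.
move=> wP am; rewrite /thue_morse_sum.
under [RHS]eq_bigr => l _ do rewrite mulr_sumr.
rewrite exchange_big /= /residue_sum big_mkcond /= mulr_sumr.
apply: eq_bigr => n _.
have -> : \sum_(l < m) w ^+ (l * (m - a)) *
      ((-1) ^+ binary_ones n * w ^+ l ^+ n) =
    (-1) ^+ binary_ones n * \sum_(l < m) w ^+ (l * (n + (m - a))).
  rewrite mulr_sumr; apply: eq_bigr => l _.
  by rewrite mulrCA -exprM -exprD -mulnDr addnC.
rewrite sum_primitive_root// mulrC.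
(* [m - a] stands for the exponent [- a], so as to stay in [nat]. *)
have -> : (m %| n + (m - a))%N = (n == a %[mod m]).
  by rewrite /dvdn -[RHS](eqn_modDr (m - a)) subnKC 1?ltnW// modnn.
by case: ifP; rewrite ?mul0r ?mulr0.
Qed.

(** * Roots of unity and chord lengths *)

Definition unit_root (R : realType) (m : nat) : R[i] :=
  Complex (cos (2 * pi / m%:R)) (sin (2 * pi / m%:R)).

(** The distance from [1] to the point of angle [2 * pi * j / m] on the unit
    circle; see [normc_sub_unit_root]. *)
Definition chord (R : realType) (m j : nat) : R :=
  2 * `|sin (pi * j%:R / m%:R)|.

Lemma unit_rootX (R : realType) (m j : nat) :
  unit_root R m ^+ j =
    Complex (cos (j%:R * (2 * pi / m%:R))) (sin (j%:R * (2 * pi / m%:R))).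
Proof.
elim: j => [|j IH]; first by rewrite expr0 mul0r cos0 sin0.
rewrite exprS IH /unit_root.
set t := 2 * pi / m%:R; have -> : j.+1%:R * t = t + j%:R * t by rewrite -natr1; ring.
rewrite cosD sinD.
by apply/eqP; rewrite eq_complex /=; apply/andP; split; apply/eqP; ring.
Qed.

Lemma normc_sub_unit_root (R : realType) (m j : nat) :
  normc (1 - unit_root R m ^+ j) = chord R m j.
Proof.
rewrite unit_rootX /chord.
have -> : j%:R * (2 * pi / m%:R) = (pi * j%:R / m%:R) *+ 2 :> R.
  by rewrite -mulr_natl; ring.
move: (pi * j%:R / m%:R) => t; rewrite /normc /=.
rewrite cos_mulr2n sin_mulr2n.
have -> : (1 - (cos t ^+ 2 *+ 2 - 1)) ^+ 2 + (0 - (cos t * sin t) *+ 2) ^+ 2 =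
    (2 * sin t) ^+ 2.
  have c2 := cos2sin2 t.
  have -> : (0 - (cos t * sin t) *+ 2) ^+ 2 = 4 * cos t ^+ 2 * sin t ^+ 2 by ring.
  by rewrite c2; ring.
by rewrite sqrtr_sqr normrM gtr0_norm.
Qed.

Lemma unit_root_primitive (R : realType) (m : nat) :
  (0 < m)%N -> m.-primitive_root (unit_root R m).
Proof.
move=> m0; have mR : m%:R != 0 :> R by rewrite pnatr_eq0 -lt0n.
rewrite /primitive_root_of_unity m0; apply/forallP => i /=.
rewrite unity_rootE; case: (eqVneq i.+1 m) => [->|im].
  by rewrite eqb_id unit_rootX mulrC divfK// mulr_natl cos2pi sin2pi eq_complex /= !eqxx.
have im' : (i.+1 < m)%N by rewrite ltn_neqAle im ltn_ord.
rewrite eqbF_neg; apply/negP => /eqP w1.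
have := normc_sub_unit_root R m i.+1; rewrite w1 subrr normc0 => /esym/eqP.
rewrite /chord mulf_eq0 pnatr_eq0 /= normr_eq0 gt_eqF//.
rewrite sin_gt0_pi// divr_gt0 ?mulr_gt0 ?pi_gt0 ?ltr0n//=.
by rewrite ltr_pdivrMr ?ltr0n// ltr_pM2l ?pi_gt0// ltr_nat.
Qed.

Lemma normc_unit_root (R : realType) (m j : nat) : normc (unit_root R m ^+ j) = 1.
Proof. by rewrite unit_rootX /normc cos2Dsin2 sqrtr1. Qed.

Lemma normc_ge0 (R : realType) (z : R[i]) : 0 <= normc z.
Proof. by case: z => a b; rewrite sqrtr_ge0. Qed.

Lemma normc_real (R : realType) (x : R) : normc (real_complex R x) = `|x|.
Proof. by rewrite /normc /= expr0n addr0 sqrtr_sqr. Qed.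

Lemma normc_prod (R : realType) (I : Type) (s : seq I) (P : pred I) (f : I -> R[i]) :
  normc (\prod_(i <- s | P i) f i) = \prod_(i <- s | P i) normc (f i).
Proof. by apply: (big_morph (@normc R) (@normcM R) (@normc1 R)). Qed.

Lemma le_normc_sum (R : realType) (I : Type) (s : seq I) (P : pred I) (f : I -> R[i]) :
  normc (\sum_(i <- s | P i) f i) <= \sum_(i <- s | P i) normc (f i).
Proof.
elim/big_rec2: _ => [|i y1 y2 _ le12]; first by rewrite normc0.
exact: le_trans (le_normcD _ _) (lerD _ _).
Qed.

Lemma normc_sign (R : realType) (n : nat) : normc ((-1) ^+ n : R[i]) = 1.
Proof.
by rewrite -(rmorphN1 (real_complex R)) -rmorphXn normc_real normrX normrN1 expr1n.
Qed.

Lemma normc_thue_morse_sum_pow2 (R : realType) (m l n : nat) :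
  normc (thue_morse_sum _ (unit_root R m ^+ l) (2 ^ n)) =
    \prod_(k < n) chord R m (l * 2 ^ k).
Proof.
rewrite thue_morse_sum_pow2 normc_prod; apply: eq_bigr => k _.
by rewrite -exprM normc_sub_unit_root.
Qed.

Lemma chord_ge0 (R : realType) (m j : nat) : 0 <= chord R m j.
Proof. by rewrite -normc_sub_unit_root normc_ge0. Qed.

Lemma chord_le2 (R : realType) (m j : nat) : chord R m j <= 2.
Proof. by rewrite /chord ler_piMr// sin_max. Qed.

(** Read through [normc_sub_unit_root], a chord depends only on a power of an
    [m]-th root of unity. *)
Lemma chord_mod (R : realType) (m i j : nat) : (0 < m)%N -> i = j %[mod m] ->
  chord R m i = chord R m j.
Proof.
move=> m0 ij; rewrite -!normc_sub_unit_root.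
have wP := unit_root_primitive R m m0.
by rewrite -(prim_expr_mod wP i) ij (prim_expr_mod wP).
Qed.

Lemma chord_gt0 (R : realType) (m j : nat) :
  (0 < m)%N -> ~~ (m %| j)%N -> 0 < chord R m j.
Proof.
move=> m0 mj; rewrite lt_def chord_ge0 andbT -normc_sub_unit_root.
apply: contra mj => /eqP /eq0_normc /eqP.
by rewrite subr_eq0 eq_sym (prim_order_dvd (unit_root_primitive R m m0)).
Qed.

(** * From dyadic lengths to all lengths *)

(** Cutting off the leading binary digit of [N] writes the sum up to [N] as a
    dyadic sum plus a unit multiple of a shorter sum, so that the bounds add up
    to a geometric series of ratio [rho]. *)
Lemma normc_thue_morse_sum_le (R : realType) (z : R[i]) (C rho : R) :
  normc z = 1 -> 1 < rho ->
  (forall k, normc (thue_morse_sum _ z (2 ^ k)) <= C * rho ^+ k) ->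
  forall k N, (N <= 2 ^ k)%N ->
    normc (thue_morse_sum _ z N) <= C * rho / (rho - 1) * rho ^+ k.
Proof.
move=> z1 rho1 Hpow; set D := C * rho / (rho - 1).
have rho0 : 0 < rho - 1 by rewrite subr_gt0.
have C0 : 0 <= C.
  by have := Hpow 0%N; rewrite expr0 mulr1; apply: le_trans; exact: normc_ge0.
have D0 : 0 <= D by rewrite divr_ge0 ?mulr_ge0//; lra.
(* [D] solves [D * rho = C * rho + D], the induction step, and [C <= D] is its
   base. *)
have DE : D * rho = C * rho + D by rewrite /D; field; rewrite gt_eqF.
have CD : C <= D.
  have -> : D = C + C / (rho - 1) by rewrite /D; field; rewrite gt_eqF.
  by rewrite lerDl divr_ge0// ltW.
elim=> [|k IH] N Nk.
  rewrite mulr1; apply: le_trans CD; case: N Nk => [|[|//]] _.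
    by rewrite /thue_morse_sum big_ord0 normc0.
  by have := Hpow 0%N; rewrite mulr1.
have [Nk'|kN] := leqP N (2 ^ k).
  apply: le_trans (IH _ Nk') _; rewrite ler_wpM2l// exprS ler_peMl ?exprn_ge0//; lra.
have [M NE] : exists M, N = (1 * 2 ^ k + M)%N by exists (N - 2 ^ k)%N; lia.
have Mk : (M <= 2 ^ k)%N by move: Nk; rewrite expnS NE; lia.
rewrite NE thue_morse_sum_block// mul1n; apply: le_trans (le_normcD _ _) _.
rewrite !normcM normc_sign mul1r.
have -> : normc (z ^+ (2 ^ k)) = 1.
  elim: (2 ^ k)%N => [|n zn]; first by rewrite expr0 normc1.
  by rewrite exprS normcM z1 zn mulr1.
have := Hpow k; have := IH _ Mk; rewrite mul1r.
have : C * rho ^+ k <= C * rho * rho ^+ k.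
  rewrite -mulrA ler_wpM2l//  ler_peMl ?exprn_ge0//; lra.
rewrite exprS mulrA DE mulrDl; lra.
Qed.

Lemma residue_sum_le (R : realType) (m : nat) (C rho : R) :
  (0 < m)%N -> 1 < rho ->
  (forall l k, (l < m)%N -> \prod_(i < k) chord R m (l * 2 ^ i) <= C * rho ^+ k) ->
  forall a k N, (a < m)%N -> (N <= 2 ^ k)%N ->
    `|residue_sum R m a N| <= C * rho / (rho - 1) * rho ^+ k.
Proof.
move=> m0 rho1 Hpow a k N am Nk.
have wP := unit_root_primitive R m m0.
have mR : 0 < m%:R :> R by rewrite ltr0n.
rewrite -(ler_pM2l mR) -[X in X * `|_|]gtr0_norm// -normrM.
rewrite -normc_real rmorphM rmorph_nat residue_sum_map (residue_sum_inversion _ _ _ _ _ wP am).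
apply: le_trans (le_normc_sum _ _ _ _ _) _.
rewrite mulr_natl -[X in _ *+ X]card_ord -sumr_const; apply: ler_sum => l _.
rewrite normcM normc_unit_root mul1r.
apply: normc_thue_morse_sum_le => //; first exact: normc_unit_root.
by move=> n; rewrite normc_thue_morse_sum_pow2 Hpow.
Qed.

(** * The uniform bound for products of chords *)

(** The duplication formula of the sine: squared chords evolve by the logistic
    map [y -> y * (4 - y)]. *)
Lemma chord_double (R : realType) (m j : nat) :
  chord R m (j * 2) ^+ 2 = chord R m j ^+ 2 * (4 - chord R m j ^+ 2).
Proof.
rewrite /chord !exprMn !real_normK ?num_real// natrM.
have -> : pi * (j%:R * 2) / m%:R = (pi * j%:R / m%:R) *+ 2 :> R.
  by rewrite -mulr_natl; ring.
rewrite sin_mulr2n.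
have -> t : ((cos t * sin t) *+ 2) ^+ 2 = 4 * cos t ^+ 2 * sin t ^+ 2 :> R by ring.
rewrite cos2sin2; ring.
Qed.

(** Among the squared chords [y, z] at consecutive indices, [z = y * (4 - y)]
    gives [y ^+ 2 * z = y ^+ 3 * (4 - y) <= 27], the maximum being reached at
    [y = 3].  The cube of a product of [n.+1] squared chords is, up to boundary
    factors, the product of [n] such terms; the last squared chord is kept on
    the right so that the induction can use it. *)
Lemma prod_chord_cube_le (R : realType) (m l n : nat) :
  (\prod_(k < n.+1) chord R m (l * 2 ^ k) ^+ 2) ^+ 3 <=
    4 * 27 ^+ n * (chord R m (l * 2 ^ n) ^+ 2) ^+ 2.
Proof.
have y0 i : 0 <= chord R m i ^+ 2 by rewrite exprn_ge0// chord_ge0.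
have y4 i : chord R m i ^+ 2 <= 4.
  have -> : 4 = 2 ^+ 2 :> R by ring.
  by rewrite lerXn2r ?nnegrE ?chord_ge0// chord_le2.
elim: n => [|n IH].
  by rewrite big_ord1 expr0 mulr1 exprS ler_wpM2r ?exprn_ge0 ?chord_ge0// y4.
rewrite big_ord_recr /= exprMn; set y := chord R m (l * 2 ^ n) ^+ 2 in IH *.
have zE : chord R m (l * 2 ^ n.+1) ^+ 2 = y * (4 - y).
  by rewrite expnSr mulnA chord_double.
set z := chord R m (l * 2 ^ n.+1) ^+ 2 in zE *.
have z0 : 0 <= z by exact: y0.
have yz : y ^+ 2 * z <= 27.
  rewrite zE -subr_ge0.
  have -> : 27 - y ^+ 2 * (y * (4 - y)) = (y - 3) ^+ 2 * (y ^+ 2 + 2 * y + 3) by ring.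
  have := y0 (l * 2 ^ n)%N; rewrite -/y => yy.
  by rewrite mulr_ge0 ?sqr_ge0//; have := sqr_ge0 y; lra.
apply: le_trans (ler_wpM2r _ IH) _; first exact: exprn_ge0.
have -> : 4 * 27 ^+ n * y ^+ 2 * z ^+ 3 = (4 * 27 ^+ n * z ^+ 2) * (y ^+ 2 * z).
  by ring.
have -> : 4 * 27 ^+ n.+1 * z ^+ 2 = (4 * 27 ^+ n * z ^+ 2) * 27 by rewrite exprS; ring.
by rewrite ler_wpM2l// mulr_ge0 ?exprn_ge0// mulr_ge0// exprn_ge0.
Qed.

(** In other words [2 `^ (ln 3 / ln 4)] is the square root of 3. *)
Lemma powR2_ln3_ln4 (R : realType) : (2 `^ (ln 3 / ln 4)) ^+ 2 = 3 :> R.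
Proof.
have ln2 : 0 < ln 2 :> R by rewrite ln_gt0// ltr1n.
have -> : ln 4 = ln 2 + ln 2 :> R.
  by rewrite -lnM ?posrE ?ltr0n//; congr ln; ring.
rewrite -powR_mulrn ?powR_ge0// -powRrM /powR pnatr_eq0 /=.
have -> : ln 3 / (ln 2 + ln 2) * 2 * ln 2 = ln 3 :> R.
  by field; rewrite -mulr2n mulrn_eq0/= gt_eqF.
by rewrite lnK// posrE ltr0n.
Qed.

Lemma prod_chord_le (R : realType) (m l n : nat) :
  \prod_(k < n) chord R m (l * 2 ^ k) <= 2 * (2 `^ (ln 3 / ln 4)) ^+ n.
Proof.
set rho := 2 `^ (ln 3 / ln 4); have rho0 : 0 <= rho by exact: powR_ge0.
have rho2 : rho ^+ 2 = 3 by exact: powR2_ln3_ln4.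
have rho1 : 1 <= rho by rewrite -(@ler_sqr _ 1 rho) ?nnegrE// rho2 expr1n; lra.
case: n => [|n]; first by rewrite big_ord0 expr0; lra.
apply: (@le_trans _ _ (2 * rho ^+ n)); last first.
  by rewrite ler_wpM2l// exprS ler_peMl ?exprn_ge0.
have P0 : 0 <= \prod_(k < n.+1) chord R m (l * 2 ^ k).
  by apply: prodr_ge0 => k _; exact: chord_ge0.
rewrite -ler_sqr ?nnegrE ?mulr_ge0 ?exprn_ge0// exprMn -exprM mulnC exprM rho2.
rewrite -(@ler_pXn2r _ 3) ?nnegrE ?mulr_ge0 ?exprn_ge0//.
rewrite -prodrXl; apply: le_trans (prod_chord_cube_le _ _ _ _) _.
have -> : (2 ^+ 2 * 3 ^+ n) ^+ 3 = 4 * 27 ^+ n * (4 ^+ 2) :> R.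
  have -> : 27 ^+ n = (3 ^+ n) ^+ 3 :> R.
    by rewrite -exprM mulnC exprM; congr (_ ^+ _); ring.
  by ring.
rewrite ler_wpM2l ?mulr_ge0 ?exprn_ge0// lerXn2r ?nnegrE ?exprn_ge0 ?chord_ge0//.
rewrite (_ : 4 = 2 ^+ 2 :> R); last by ring.
by rewrite lerXn2r ?nnegrE ?chord_ge0// chord_le2.
Qed.

(** * The remainder and the signed residue sums *)

Lemma ones_countE (R : realType) (m a j N : nat) (x : R) :
  (forall n, (n%:R < x) = (n < N)%N) ->
  ones_count m a j x =
    (\sum_(n < N | (n == a %[mod m]) && (binary_ones n == j %[mod 2])) 1)%N.
Proof.
move=> xN; pose P n := (n == a %[mod m])%N && (binary_ones n == j %[mod 2])%N.
rewrite /ones_count.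
have -> : [set n : nat | [/\ (n%:R < x)%R, n = a %[mod m]
                         & binary_ones n = j %[mod 2]]%N]%classic =
    [set` [fset n in [seq n <- iota 0 N | P n]]%fset]%classic.
  apply/seteqP; split => n /=; rewrite !inE /= mem_filter mem_iota /P add0n xN.
    by case=> -> -> ->; rewrite !eqxx.
  by move=> /andP[/andP[/eqP -> /eqP ->] /andP[_ ->]].
rewrite set_fsetK card_fseq undup_id ?filter_uniq ?iota_uniq//.
by rewrite size_filter -sum1_count -[N in iota 0 N]subn0 big_mkord.
Qed.

Lemma card_residue (m a N : nat) : (a < m)%N ->
  (\sum_(n < N | n == a %[mod m]) 1 = (N + (m.-1 - a)) %/ m)%N.
Proof.
move=> am; have m0 : (0 < m)%N by exact: leq_ltn_trans am.
elim: N => [|N IH]; first by rewrite big_ord0 add0n divn_small//; lia.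
rewrite big_mkcond big_ord_recr -big_mkcond /= IH addSn divnS// addnC.
congr (_ + _)%N; have -> : (m %| (N + (m.-1 - a)).+1)%N = (N == a %[mod m]).
  rewrite /dvdn -[RHS](eqn_modDr (m - a)) subnKC 1?ltnW// modnn.
  by congr (_ %% _ == _)%N; lia.
by case: ifP.
Qed.

(** Twice the indicator of [s n = j] mod 2, [s] counting binary ones, is
    [1 + (-1) ^+ (j + s n)]: the first term counts the class of [a] below [N],
    which has [N / m] elements up to an error of one, and the second gives the
    residue sum. *)
Lemma remainder_residue_sum (R : realType) (m a j N : nat) (x : R) :
  (a < m)%N -> (j < 2)%N ->
  (forall n, (n%:R < x) = (n < N)%N) -> N%:R - 1 <= x <= N%:R ->
  `|remainder m a j x - (-1) ^+ j * residue_sum R m a N / 2| <= 1.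
Proof.
move=> am j2 xN /andP[Nx1 Nx2].
have m0 : (0 < m)%N by exact: leq_ltn_trans am.
have mR : 1 <= m%:R :> R by rewrite ler1n.
rewrite /remainder (ones_countE _ _ _ _ _ _ xN).
set A := ((N + (m.-1 - a)) %/ m)%N.
have -> : (\sum_(n < N | (n == a %[mod m]) && (binary_ones n == j %[mod 2])) 1)%N%:R
    = (A%:R + (-1) ^+ j * residue_sum R m a N) / 2 :> R.
  rewrite /A -card_residue// /residue_sum mulr_sumr !natr_sum -big_split /= mulr_suml.
  rewrite big_mkcondr /=; apply: eq_bigr => n _.
  rewrite -exprD -signr_odd oddD !modn2.
  have -> : (odd (binary_ones n) == odd j :> nat) = ~~ (odd j (+) odd (binary_ones n)).
    by case: (odd j); case: (odd _).
  by case: (_ (+) _) => /=; rewrite ?expr0 ?expr1; [rewrite subrr mul0r|rewrite divff].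
(* [A] is a floor, within one of [N / m]. *)
have AN : `|m%:R * A%:R - N%:R| <= m%:R :> R.
  have := leq_trunc_div (N + (m.-1 - a)) m; rewrite -/A => A1.
  have := ltn_ceil (N + (m.-1 - a)) m0; rewrite -/A => A2.
  have {}A1 : (m * A <= N + m)%N by move: A1 am; lia.
  have {}A2 : (N <= m * A + m)%N by move: A2 am; rewrite mulSn; lia.
  rewrite -(ler_nat R) natrD natrM in A1; rewrite -(ler_nat R) natrD natrM in A2.
  rewrite ler_norml; lra.
have -> : (A%:R + (-1) ^+ j * residue_sum R m a N) / 2 - x / (2 * m%:R) -
    (-1) ^+ j * residue_sum R m a N / 2 = (m%:R * A%:R - N%:R + (N%:R - x)) / (2 * m%:R).
  by field; lra.
rewrite normrM normfV (gtr0_norm (_ : 0 < 2 * m%:R)) ?mulr_gt0//; last by lra.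
rewrite ler_pdivrMr ?mulr_gt0//; last by lra.
apply: le_trans (ler_normD _ _) _.
have : `|N%:R - x| <= 1 by rewrite ler_norml; lra.
lra.
Qed.

Lemma bigO_powRP (R : realType) (f : R -> R) (beta : R) :
  (f =O_ (pinfty_nbhs R) (fun x : R => x `^ beta)) <->
  (exists C X : R, forall x, X <= x -> `|f x| <= C * x `^ beta).
Proof.
split=> [/eqO_exP[C C0 [X [Xr fX]]]|[C [X fX]]].
  exists C, (X + 1) => x Xx; have := fX x; rewrite /= (ger0_norm (powR_ge0 _ _)).
  by apply; lra.
apply/eqO_exP; exists (`|C| + 1); first by rewrite ltr_wpDl.
exists X; split; first exact: num_real.
move=> x Xx /=; rewrite (ger0_norm (powR_ge0 _ _)).
apply: le_trans (fX x (ltW Xx)) _; rewrite ler_wpM2r ?powR_ge0//.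
by have := ler_norm C; lra.
Qed.

(** [N] being the number of naturals below [x], a power of 2 between [N] and
    [2 * x] turns geometric growth in the number of digits into a power of
    [x]. *)
Lemma remainder_bigO (R : realType) (m a j : nat) (C beta : R) :
  (a < m)%N -> (j < 2)%N -> 0 < beta ->
  (forall l k, (l < m)%N ->
     \prod_(i < k) chord R m (l * 2 ^ i) <= C * (2 `^ beta) ^+ k) ->
  (remainder m a j : R -> R) =O_ (pinfty_nbhs R) (fun x : R => x `^ beta).
Proof.
move=> am j2 beta0 Hpow; apply/bigO_powRP.
have m0 : (0 < m)%N by exact: leq_ltn_trans am.
set rho := 2 `^ beta in Hpow *.
have rho1 : 1 < rho by rewrite /rho /powR pnatr_eq0 /= expR_gt1 mulr_gt0// ln_gt0// ltr1n.
pose D := C * rho / (rho - 1).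
have D0 : 0 <= D.
  have := residue_sum_le _ _ _ _ m0 rho1 Hpow _ 0%N 0%N am isT.
  by rewrite mulr1; apply: le_trans.
exists (D * rho + 1), 1 => x x1.
(* [N] is the least natural number that is at least [x]. *)
have [N0 xN0] : exists N : nat, (x <= N%:R).
  by exists (Num.bound x); rewrite ltW// archi_boundP//; lra.
case: (ex_minnP (ex_intro (fun N : nat => x <= N%:R) N0 xN0)) => N xN Nmin.
have Npos : (0 < N)%N by rewrite -(ltr_nat R); lra.
have xltN n : (n%:R < x) = (n < N)%N.
  apply/idP/idP => [nx|nN]; first by rewrite -(ltr_nat R); exact: lt_le_trans xN.
  by rewrite ltNge; apply/negP => /Nmin; lia.
have Nx : N%:R - 1 < x.
  by rewrite -(prednK Npos) -natr1 addrK xltN; lia.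
have := remainder_residue_sum _ _ _ _ _ _ am j2 xltN.
rewrite (ltW Nx) xN => /(_ isT) rem.
pose k := up_log 2 N.
have Nk : (N <= 2 ^ k)%N by exact: up_logP.
have k2x : (2 ^ k)%:R <= 2 * x.
  rewrite /k; case: (leqP N 1) => [N1|N1].
    have -> : N = 1%N by apply/eqP; rewrite eqn_leq N1.
    by rewrite up_log1; lra.
  have := up_log_bounds (isT : (1 < 2)%N) N1 => /andP[lo _].
  have k0 : (0 < up_log 2 N)%N by rewrite up_log_gt0.
  rewrite -(prednK k0) expnS natrM ler_pM2l//.
  have : ((2 ^ (up_log 2 N).-1)%:R <= (N.-1)%:R :> R) by rewrite ler_nat; lia.
  have : N.-1%:R < x by rewrite xltN ltn_predL.
  lra.
have rhok : rho ^+ k <= rho * x `^ beta.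
  rewrite /rho -powRM//; last lra.
  rewrite -powR_mulrn ?powR_ge0// -powRrM mulrC powRrM powR_mulrn//.
  by rewrite ge0_ler_powR ?nnegrE// ?(ltW beta0)// -?natrX//; lra.
have := residue_sum_le _ _ _ _ m0 rho1 Hpow _ _ _ am Nk; rewrite -/D => S.
have xb1 : 1 <= x `^ beta.
  have := ge0_ler_powR (ltW beta0) (x := 1) (y := x); rewrite powR1 !nnegrE; apply; lra.
have : `|(-1) ^+ j * residue_sum R m a N / 2| <= `|residue_sum R m a N|.
  rewrite -mulrA normrM normrX normrN1 expr1n mul1r normrM normfV.
  by rewrite (@ger0_norm _ 2)//; have := normr_ge0 (residue_sum R m a N); lra.
have : D * rho ^+ k <= D * rho * x `^ beta by rewrite -mulrA ler_wpM2l.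
have := ler_distD ((-1) ^+ j * residue_sum R m a N / 2) (remainder m a j x) 0.
rewrite !subr0 mulrDl mul1r; lra.
Qed.

(** * Cyclotomic cosets and the period of chord products *)

(** The coset of 1 consists of the powers of 2.  By pigeonhole two of the first
    [#|C|.+1] powers agree, so [2 ^ d = 1] for some positive [d <= #|C|]; as the
    powers then repeat with period [d], also [#|C| <= d]. *)
Lemma pow2_card_coset1 (m : nat) : (1 < m)%N -> odd m ->
  2 ^ #|cyclotomic_coset m 1| = 1 %[mod m].
Proof.
move=> m1 modd; have m0 : (0 < m)%N by exact: ltnW.
set C := cyclotomic_coset m 1.
pose f (i : nat) : 'I_m := Ordinal (ltn_pmod (2 ^ i) m0).
have fC i : f i \in C by rewrite inE; apply/asboolP; exists i; rewrite mul1n.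
have /injectivePn[i [j ij fij]] : ~~ injectiveb (fun i : 'I_#|C|.+1 => f i).
  apply/negP => /injectiveP finj.
  have : ((fun i : 'I_#|C|.+1 => f i) @: predT \subset C)%SET.
    by apply/fintype.subsetP => _ /imsetP[k _ ->].
  by move=> /subset_leq_card; rewrite (card_imset _ finj) card_ord ltnn.
wlog ltij : i j ij fij / (i < j)%N.
  move=> W; case: (ltngtP i j) => [lt|lt|eq]; first exact: (W i j).
  - by apply: (W j i) => //; rewrite eq_sym.
  - by move: ij; rewrite -val_eqE /= eq eqxx.
pose d := (j - i)%N.
have d0 : (0 < d)%N by rewrite subn_gt0.
have pow2d : 2 ^ d = 1 %[mod m].
  apply/eqP; rewrite eqn_mod_dvd ?expn_gt0//.
  have co : coprime m (2 ^ i) by rewrite coprimeXr// coprimen2.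
  rewrite -(Gauss_dvdr _ co) mulnBr muln1 -expnD subnKC 1?ltnW//.
  rewrite -eqn_mod_dvd; last by rewrite leq_exp2l// ltnW.
  by move/(congr1 val): fij => /= <-.
suff Cd : #|C| = d by rewrite Cd.
apply/eqP; rewrite eqn_leq; apply/andP; split; last first.
  by rewrite leq_subLR; have := ltn_ord j; lia.
have -> : d = #|'I_d| by rewrite card_ord.
apply: leq_trans (leq_imset_card (fun k : 'I_d => f k) _); apply: subset_leq_card.
apply/fintype.subsetP => c; rewrite inE => /asboolP[k ck].
apply/imsetP; exists (Ordinal (ltn_pmod k d0)) => //; apply: val_inj => /=.
rewrite ck mul1n {1}(divn_eq k d) expnD [(_ %/ _ * _)%N]mulnC expnM -modnMml -modnXm pow2d.
by rewrite modnXm exp1n modnMml mul1n.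
Qed.

Lemma coset_lcm_gt0 (m : nat) : (0 < coset_lcm m)%N.
Proof.
rewrite /coset_lcm; elim/big_ind: _ => // [p q p0 q0|C /imsetP[t _ ->]].
  by rewrite lcmn_gt0 p0.
apply/card_gt0P; exists t; rewrite inE; apply/asboolP; exists 0%N.
by rewrite expn0 muln1 modn_small.
Qed.

Lemma pow2_coset_lcm (m : nat) : (1 < m)%N -> odd m -> 2 ^ coset_lcm m = 1 %[mod m].
Proof.
move=> m1 modd; have : (#|cyclotomic_coset m 1| %| coset_lcm m)%N.
  rewrite /coset_lcm (@biglcmn_sup _ (cyclotomic_coset m 1))//.
  by apply/imsetP; exists (Ordinal m1); rewrite ?inE.
move=> /dvdnP[k ->]; rewrite mulnC expnM -modnXm pow2_card_coset1//.
by rewrite modnXm exp1n.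
Qed.

Lemma prod_chord_period (R : realType) (m l q r : nat) : (1 < m)%N -> odd m ->
  \prod_(k < q * coset_lcm m + r) chord R m (l * 2 ^ k) =
    (\prod_(k < coset_lcm m) chord R m (l * 2 ^ k)) ^+ q *
    \prod_(k < r) chord R m (l * 2 ^ k).
Proof.
move=> m1 modd; set h := coset_lcm m; elim: q => [|q IH]; first by rewrite mul1r.
rewrite mulSn -addnA big_split_ord /= exprS -mulrA -IH; congr (_ * _).
apply: eq_bigr => k _; apply: chord_mod; first exact: ltnW.
by rewrite expnD mulnCA -modnMml pow2_coset_lcm// modnMml mul1n.
Qed.

Lemma prod_chord_exponent (R : realType) (m l : nat) : (0 < m)%N -> odd m ->
  ~~ (m %| l)%N ->
  \prod_(k < coset_lcm m) chord R m (l * 2 ^ k) =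
    (2 `^ exponent_term R m l) ^+ coset_lcm m.
Proof.
move=> m0 modd ml; set h := coset_lcm m.
have hR : h%:R != 0 :> R by rewrite pnatr_eq0 -lt0n coset_lcm_gt0.
have ln2 : ln 2 != 0 :> R by rewrite gt_eqF// ln_gt0// ltr1n.
have s0 k : 0 < `|sin (pi * l%:R * 2 ^+ k / m%:R)| :> R.
  have : 0 < chord R m (l * 2 ^ k).
    apply: chord_gt0 => //; apply: contra ml.
    by rewrite Gauss_dvdl// coprimeXr// coprimen2.
  by rewrite /chord natrM natrX mulrA pmulr_rgt0.
rewrite -powR_mulrn ?powR_ge0// -powRrM /powR pnatr_eq0 /=.
have -> : exponent_term R m l * h%:R * ln 2 =
    \sum_(k < h) (ln 2 + ln `|sin (pi * l%:R * 2 ^+ k / m%:R)|).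
  rewrite big_split /= sumr_const card_ord -mulr_natl /exponent_term big_mkord.
  by rewrite -/h; field; rewrite ln2.
rewrite expR_sum; apply: eq_bigr => k _.
by rewrite expRD !lnK ?posrE// /chord natrM natrX mulrA.
Qed.

(** * The maximal exponent *)

Lemma exponent_term_le_max (R : realType) (m l : nat) : (0 < l < m)%N ->
  exponent_term R m l <= max_exponent R m.
Proof.
by move=> lm; rewrite /max_exponent le_bigmax_seq// mem_index_iota.
Qed.

Lemma max_exponent_attained (R : realType) (m : nat) : (1 < m)%N ->
  exists2 l, (0 < l < m)%N & max_exponent R m = exponent_term R m l.
Proof.
move=> m1; rewrite /max_exponent big_nat_cond.
elim/big_ind: _ => [|_ _ [l1 H1 ->] [l2 H2 ->]|l /andP[lm _]]; first by exists 1%N.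
  by rewrite maxEle; case: ifP => _; [exists l2|exists l1].
by exists l.
Qed.

(** Divide ['X^m - 1], the product of all ['X - w ^+ l], by ['X - 1] and
    evaluate at 1. *)
Lemma prod_one_sub_primitive_root (A : fieldType) (m : nat) (w : A) :
  m.-primitive_root w -> \prod_(1 <= l < m) (1 - w ^+ l) = m%:R.
Proof.
move=> wP; have m0 := prim_order_gt0 wP.
have E : \prod_(1 <= l < m) ('X - (w ^+ l)%:P) = \sum_(i < m) 'X^i :> {poly A}.
  apply: (mulfI (x := 'X - 1%:P)); first by rewrite polyXsubC_eq0.
  transitivity ('X^m - 1 : {poly A}); last by rewrite (subrX1 'X m) polyC1.
  apply: etrans (factor_Xn_sub_1 wP).
  by rewrite [RHS]big_ltn.
have := congr1 (fun p => p.[1]) E; rewrite horner_prod horner_sum /=.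
rewrite (eq_bigr (fun l => 1 - w ^+ l)) => [->|l _]; last by rewrite hornerXsubC.
by rewrite (eq_bigr (fun=> 1)) ?sumr_const ?card_ord// => l _; rewrite hornerXn expr1n.
Qed.

(** For each [k], [w ^+ (2 ^ k)] is again a primitive root, so the chords
    [l * 2 ^ k] for [0 < l < m] have product [m].  If no exponent were positive,
    the product [m ^ h] of all the chords would be at most 1. *)
Lemma max_exponent_gt0 (R : realType) (m : nat) : (1 < m)%N -> odd m ->
  0 < max_exponent R m.
Proof.
move=> m1 modd; have m0 : (0 < m)%N by exact: ltnW.
set h := coset_lcm m; have h0 : (0 < h)%N by exact: coset_lcm_gt0.
have prodE : \prod_(1 <= l < m) \prod_(k < h) chord R m (l * 2 ^ k) = m%:R ^+ h.
  rewrite exchange_big /= -[in RHS](card_ord h) -prodr_const.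
  apply: eq_bigr => k _.
  have wP : m.-primitive_root (unit_root R m ^+ (2 ^ k)).
    by rewrite prim_root_exp_coprime ?unit_root_primitive// coprimeXl// coprime2n.
  have := congr1 (@normc R) (prod_one_sub_primitive_root _ _ _ wP).
  rewrite normc_prod -(rmorph_nat (real_complex R)) normc_real normr_nat => <-.
  by apply: eq_bigr => l _; rewrite -exprM mulnC normc_sub_unit_root.
rewrite ltNge; apply/negP => max0.
have : \prod_(1 <= l < m) \prod_(k < h) chord R m (l * 2 ^ k) <= 1.
  rewrite big_nat_cond; apply: prodr_ile1 => l /andP[lm _].
  rewrite prodr_ge0 => [|k _]; last exact: chord_ge0.
  rewrite prod_chord_exponent//; last by rewrite gtnNdvd//; case/andP: lm.
  have e0 := le_trans (exponent_term_le_max _ _ _ lm) max0.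
  rewrite exprn_ile1 ?powR_ge0//.
  by rewrite -[leRHS](powRr0 2) ler_powR// ler1n.
by rewrite prodE leNgt exprn_egt1 ?ltr1n// -lt0n h0.
Qed.

(** Whole periods contribute exactly [exponent_term]; the constant [2 ^+ h]
    absorbs the incomplete one. *)
Lemma prod_chord_le_max (R : realType) (m l k : nat) : (1 < m)%N -> odd m ->
  (l < m)%N ->
  \prod_(i < k) chord R m (l * 2 ^ i) <=
    2 ^+ coset_lcm m * (2 `^ max_exponent R m) ^+ k.
Proof.
move=> m1 modd lm; have m0 : (0 < m)%N by exact: ltnW.
set h := coset_lcm m; set rho := 2 `^ max_exponent R m.
have rho1 : 1 <= rho by rewrite -[leLHS](powRr0 2) ler_powR ?ler1n// ltW// max_exponent_gt0.
case: (posnP l) => [->|l0].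
  case: k => [|k]; first by rewrite big_ord0 mulr1 exprn_ege1// ler1n.
  rewrite big_ord_recl /= mul0n {1}/chord mulr0 mul0r sin0 normr0 mulr0 mul0r.
  by rewrite mulr_ge0 ?exprn_ge0// powR_ge0.
have h0 : (0 < h)%N by exact: coset_lcm_gt0.
have := prod_chord_period R m l (k %/ h) (k %% h) m1 modd.
rewrite -/h -divn_eq => ->; rewrite prod_chord_exponent ?gtnNdvd//.
rewrite mulrC ler_pM ?exprn_ge0 ?powR_ge0//.
- by apply: prodr_ge0 => i _; exact: chord_ge0.
- apply: (@le_trans _ _ (2 ^+ (k %% h))).
    rewrite -[in leRHS](card_ord (k %% h)) -prodr_const; apply: ler_prod => i _.
    by rewrite chord_ge0 chord_le2.
  by rewrite ler_weXn2l ?ler1n// ltnW// ltn_pmod.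
- rewrite -exprM; apply: (@le_trans _ _ (rho ^+ (h * (k %/ h)))).
    rewrite lerXn2r ?nnegrE ?powR_ge0// ler_powR ?ler1n//.
    by rewrite exponent_term_le_max// l0.
  by rewrite ler_weXn2l// mulnC leq_trunc_div.
Qed.

(** * No smaller power bounds the remainder *)

(** If [beta < e] then the ratio of the two sides grows at least linearly
    in [q], by [1 + t <= exp t]. *)
Lemma exponent_le_of_powers (R : realType) (h : nat) (K e beta : R) : (0 < h)%N ->
  (\forall q \near \oo%classic, (2 `^ e) ^+ (q * h) <= K * (2 `^ beta) ^+ (q * h)) ->
  e <= beta.
Proof.
move=> h0 [Q _ HQ]; rewrite leNgt; apply/negP => be.
pose d := (e - beta) * ln 2.
have d0 : 0 < d by rewrite mulr_gt0 ?subr_gt0// ln_gt0// ltr1n.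
have bound (q : nat) : (Q <= q)%N -> q%:R * d <= K.
  move=> Qq; have := HQ q Qq.
  rewrite -ler_pdivrMr ?exprn_gt0 ?powR_gt0// -expr_div_n -powRB ?pnatr_eq0 ?implybT//.
  rewrite /powR pnatr_eq0 /= -/d -expRM_natl; apply: le_trans.
  have : (q%:R : R) <= (q * h)%:R by rewrite ler_nat leq_pmulr.
  move: ((q * h)%:R) => n qn; have : q%:R * d <= n * d by rewrite ler_pM2r.
  by have := expR_ge1Dx (n * d); lra.
have [q Kq] : exists q : nat, K / d < q%:R.
  by exists (Num.bound `|K / d|); rewrite (le_lt_trans (ler_norm _))// archi_boundP.
have := bound (maxn q Q) (leq_maxr _ _); apply/negP; rewrite -ltNge.
rewrite -ltr_pdivrMr//; apply: lt_le_trans Kq _.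
by rewrite ler_nat leq_maxl.
Qed.

Lemma residue_sum_of_remainder_bigO (R : realType) (m a j : nat) (beta : R) :
  (a < m)%N -> (j < 2)%N -> 0 < beta ->
  (remainder m a j : R -> R) =O_ (pinfty_nbhs R) (fun x : R => x `^ beta) ->
  exists2 K : R, 0 <= K &
    \forall N \near \oo%classic, `|residue_sum R m a N| <= K * N%:R `^ beta.
Proof.
move=> am j2 beta0 /bigO_powRP[C [X HX]].
have [Q XQ] : exists Q : nat, X < Q%:R.
  by exists (Num.bound `|X|); rewrite (le_lt_trans (ler_norm _))// archi_boundP.
exists (2 * (`|C| + 1)); first by rewrite mulr_ge0// addr_ge0.
exists (maxn 1 Q) => [//|N NQ]; have := NQ : (maxn 1 Q <= N)%N; rewrite geq_max => /andP[N1 QN].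
have XN : X <= N%:R by rewrite ltW// (lt_le_trans XQ)// ler_nat.
have b1 : 1 <= N%:R `^ beta :> R.
  have := ge0_ler_powR (ltW beta0) (x := 1) (y := N%:R).
  by rewrite powR1 !nnegrE ler0n ler1n; apply.
have := remainder_residue_sum R m a j N N%:R am j2 (fun n => ltr_nat R n N).
rewrite lexx andbT gerBl ler01 => /(_ isT).
have : `|residue_sum R m a N| = 2 * `|(-1) ^+ j * residue_sum R m a N / 2|.
  rewrite -mulrA normrM normrX normrN1 expr1n mul1r normrM normfV.
  by rewrite (@ger0_norm _ 2)//; field.
have := HX _ XN; move: (_ / 2) (remainder _ _ _ _) => s r rC -> rs.
have : C * N%:R `^ beta <= `|C| * N%:R `^ beta by rewrite ler_wpM2r ?powR_ge0// ler_norm.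
have := ler_distD r s 0; rewrite !subr0 (distrC s r); lra.
Qed.

(** As [2 ^ (q * h) = 1] mod [m], the block of index [b = a + m - c] sees the
    class of [a] as the class of [c].  This [b] lies between 1 and [2 * m - 1]:
    both endpoints of the block tend to infinity, within a constant factor of
    [2 ^ (q * h)]. *)
Lemma residue_sum_transfer (R : realType) (m a h c : nat) (K beta : R) :
  (a < m)%N -> (c < m)%N -> 0 < beta -> 0 <= K -> (0 < h)%N ->
  2 ^ h = 1 %[mod m] ->
  (\forall N \near \oo%classic, `|residue_sum R m a N| <= K * N%:R `^ beta) ->
  \forall q \near \oo%classic, `|residue_sum R m c (2 ^ (q * h))| <=
    2 * K * (2 * m)%:R `^ beta * (2 `^ beta) ^+ (q * h).
Proof.
move=> am cm beta0 K0 h0 hm [Q _ HQ]; exists Q => //= q Qq.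
pose b := (a + (m - c))%N.
have [b1 b2] : (0 < b)%N /\ (b < 2 * m)%N by rewrite /b; clear -am cm; lia.
set n := (q * h)%N.
have Qn : (Q <= 2 ^ n)%N.
  by apply: leq_trans Qq _; apply: leq_trans (ltnW (ltn_expl n _)) => //; rewrite leq_pmulr.
have nm : 2 ^ n = 1 %[mod m] by rewrite /n mulnC expnM -modnXm hm modnXm exp1n.
(* [b * 2 ^ n + c] is congruent to [b + c = a + m]. *)
have bca : b * 2 ^ n + c = a %[mod m].
  rewrite -modnDml -modnMmr nm modnMmr muln1 modnDml /b -addnA subnK 1?ltnW//.
  by rewrite modnDr.
have := residue_sum_block R m b n c (2 ^ n) (leqnn _).
have sumE N : residue_sum R m (b * 2 ^ n + c) N = residue_sum R m a N.
  by rewrite /residue_sum; apply: eq_bigl => i; rewrite bca.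
rewrite !sumE => E.
have -> : `|residue_sum R m c (2 ^ n)| =
    `|residue_sum R m a (b * 2 ^ n + 2 ^ n) - residue_sum R m a (b * 2 ^ n)|.
  by rewrite E addrAC subrr add0r normrM normrX normrN1 expr1n mul1r.
have bnd N : (2 ^ n <= N <= 2 * m * 2 ^ n)%N ->
    `|residue_sum R m a N| <= K * (2 * m)%:R `^ beta * (2 `^ beta) ^+ n.
  move=> /andP[N1 N2]; apply: le_trans (HQ N (leq_trans Qn N1)) _.
  rewrite -mulrA ler_wpM2l// -[_ ^+ n]powR_mulrn ?powR_ge0// -powRrM.
  rewrite [_ * n%:R]mulrC powRrM powR_mulrn// -powRM ?exprn_ge0//.
  rewrite ge0_ler_powR ?nnegrE ?(ltW beta0)//.
  by rewrite -natrX -natrM ler_nat.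
apply: le_trans (ler_normB _ _) _.
have N1 : (2 ^ n <= b * 2 ^ n + 2 ^ n <= 2 * m * 2 ^ n)%N.
  by rewrite leq_addl addnC -mulSn leq_mul2r b2 orbT.
have N2 : (2 ^ n <= b * 2 ^ n <= 2 * m * 2 ^ n)%N.
  by rewrite leq_pmull// leq_mul2r ltnW// orbT.
have := bnd _ N1; have := bnd _ N2; lra.
Qed.

(** Evaluate at the index [l] where the maximum is attained: all the residue
    sums at [2 ^ (q * h)] are [O(2 ^ (q * h * beta))], hence so is their Fourier
    coefficient of index [l], of modulus [2 ^ (q * h * max_exponent)]. *)
Lemma max_exponent_le_of_bigO_pos (R : realType) (m a j : nat) (beta : R) :
  (1 < m)%N -> odd m -> (a < m)%N -> (j < 2)%N -> 0 < beta ->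
  (remainder m a j : R -> R) =O_ (pinfty_nbhs R) (fun x : R => x `^ beta) ->
  max_exponent R m <= beta.
Proof.
move=> m1 modd am j2 beta0 /(residue_sum_of_remainder_bigO _ _ _ _ _ am j2 beta0)[K K0 HK].
have m0 : (0 < m)%N by exact: ltnW.
have [l lm ->] := max_exponent_attained R m m1.
set h := coset_lcm m; have h0 : (0 < h)%N by exact: coset_lcm_gt0.
have hm : 2 ^ h = 1 %[mod m] by exact: pow2_coset_lcm.
pose D := 2 * K * (2 * m)%:R `^ beta.
have HD : \forall q \near \oo%classic, forall c : 'I_m,
    `|residue_sum R m c (2 ^ (q * h))| <= D * (2 `^ beta) ^+ (q * h).
  by apply: filter_forall => c; exact: (residue_sum_transfer _ _ _ _ _ _ _ am).
apply: (exponent_le_of_powers R h (m%:R * D)) => //.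
apply: filterS HD => q HD.
have wP := unit_root_primitive R m m0.
have -> : (2 `^ exponent_term R m l) ^+ (q * h) =
    normc (thue_morse_sum _ (unit_root R m ^+ l) (2 ^ (q * h))).
  rewrite normc_thue_morse_sum_pow2 -[(q * h)%N in RHS]addn0 prod_chord_period//.
  rewrite prod_chord_exponent//; last by rewrite gtnNdvd//; case/andP: lm.
  by rewrite big_ord0 mulr1 -exprM mulnC.
rewrite (thue_morse_sum_residues _ m)// ?(prim_expr_order wP)//.
apply: le_trans (le_normc_sum _ _ _ _ _) _.
rewrite -mulrA mulr_natl -[X in _ *+ X]card_ord -sumr_const; apply: ler_sum => c _.
rewrite normcM normc_unit_root mul1r.
by rewrite -(residue_sum_map _ _ (real_complex R)) normc_real.
Qed.

Lemma bigO_powR_le (R : realType) (f : R -> R) (beta gamma : R) : beta <= gamma ->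
  f =O_ (pinfty_nbhs R) (fun x : R => x `^ beta) ->
  f =O_ (pinfty_nbhs R) (fun x : R => x `^ gamma).
Proof.
move=> bg /bigO_powRP[C [X HX]]; apply/bigO_powRP.
exists `|C|, (Num.max 1 X) => x; rewrite ge_max => /andP[x1 Xx].
apply: le_trans (HX _ Xx) _.
apply: (@le_trans _ _ (`|C| * x `^ beta)); first by rewrite ler_wpM2r ?powR_ge0// ler_norm.
by rewrite ler_wpM2l// ler_powR.
Qed.

(** Without a sign condition on [beta] the bounded error terms could dominate;
    comparing with half of the positive maximal exponent removes this case. *)
Lemma max_exponent_le_of_bigO (R : realType) (m a j : nat) (beta : R) :
  (1 < m)%N -> odd m -> (a < m)%N -> (j < 2)%N ->
  (remainder m a j : R -> R) =O_ (pinfty_nbhs R) (fun x : R => x `^ beta) ->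
  max_exponent R m <= beta.
Proof.
move=> m1 modd am j2 Ob; have max0 := max_exponent_gt0 R m m1 modd.
have [half|/ltW half] := leP (max_exponent R m / 2) beta.
  by apply: max_exponent_le_of_bigO_pos Ob => //; lra.
suff : max_exponent R m <= max_exponent R m / 2 by lra.
apply: (max_exponent_le_of_bigO_pos _ _ a j) => //; first lra.
exact: bigO_powR_le Ob.
Qed.

Lemma littleo_powR_of_bigO (R : realType) (f : R -> R) (beta gamma : R) : beta < gamma ->
  f =O_ (pinfty_nbhs R) (fun x : R => x `^ beta) ->
  f =o_ (pinfty_nbhs R) (fun x : R => x `^ gamma).
Proof.
move=> bg /bigO_powRP[C [X HX]]; apply/eqoP => e e0.
pose d := gamma - beta; have d0 : 0 < d by rewrite subr_gt0.
(* Beyond [Y], the factor [x `^ d] exceeds [(`|C| + 1) / e]. *)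
pose Y := ((`|C| + 1) / e) `^ d^-1.
exists (Num.max (Num.max 1 X) Y); split; first exact: num_real.
move=> x; rewrite !gt_max => /andP[/andP[x1 Xx] Yx] /=.
rewrite (ger0_norm (powR_ge0 _ _)); apply: le_trans (HX _ (ltW Xx)) _.
have x0 : 0 < x by lra.
have -> : x `^ gamma = x `^ d * x `^ beta.
  by rewrite -powRD ?subrK// (gt_eqF x0) implybT.
rewrite mulrA ler_wpM2r ?powR_ge0//.
have C1 : 0 <= (`|C| + 1) / e by rewrite divr_ge0 ?addr_ge0// ltW.
have : (`|C| + 1) / e <= x `^ d.
  have <- : Y `^ d = (`|C| + 1) / e by rewrite /Y -powRrM mulVf ?gt_eqF// powRr1.
  by rewrite ge0_ler_powR ?nnegrE ?powR_ge0// ltW.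
rewrite ler_pdivrMr// mulrC; have := ler_norm C; lra.
Qed.

Theorem theorem1 (R : realType) (m : nat) (m_ge3 : (3 <= m)%N) (m_odd : odd m) :
  (forall a j : nat, (a < m)%N -> (j < 2)%N ->
     (remainder m a j : R -> R) =O_ (pinfty_nbhs R) (fun x : R => x `^ (ln 3 / ln 4))) /\
  (forall alpha : R, is_exact_exponent m alpha <-> alpha = max_exponent R m).
Proof.
have m1 : (1 < m)%N by exact: ltnW.
have m0 : (0 < m)%N by exact: ltnW.
have max0 := max_exponent_gt0 R m m1 m_odd.
have Omax a j : (a < m)%N -> (j < 2)%N ->
    (remainder m a j : R -> R) =O_ (pinfty_nbhs R) (fun x : R => x `^ max_exponent R m).
  move=> am j2; apply: remainder_bigO => // l k lm.
  exact: prod_chord_le_max.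
split=> [a j am j2|alpha].
  apply: (remainder_bigO _ _ _ _ 2) => // [|l k _]; last exact: prod_chord_le.
  by rewrite divr_gt0// ln_gt0// ltr1n.
split=> [exact_alpha|->].
  apply/le_anti/andP; split.
    rewrite leNgt; apply/negP => lt.
    have e0 : 0 < (alpha - max_exponent R m) / 2 by rewrite divr_gt0// subr_gt0.
    have [_ []] := exact_alpha 0%N 0%N m0 isT _ e0.
    by apply: littleo_powR_of_bigO (Omax 0%N 0%N m0 isT); lra.
  apply/ler_addgt0Pr => e e0.
  have [Oe _] := exact_alpha 0%N 0%N m0 isT _ e0.
  exact: (max_exponent_le_of_bigO _ _ 0%N 0%N).
move=> a j am j2 e e0; split.
  by apply: bigO_powR_le (Omax a j am j2); lra.
move=> o; have /(max_exponent_le_of_bigO _ _ _ _ _ m1 m_odd am j2) :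
  (remainder m a j : R -> R) =O_ (pinfty_nbhs R) (fun x : R => x `^ (max_exponent R m - e)).
  by rewrite o; exact: eqoO.
lra.
Qed.
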